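(* Let $G$ be a graph. For any $x\in \mathbb{N}$ and any integer $y\geq -1$, $$Z_G(x,y)=|\mathcal{PC}_{x,y+1}(G)|.$$ For any $x\in \mathbb{N}$ and any integer $y\geq 1$, $$Z_G(x,-y)=\sum_{(c_V,c_E)\in \mathcal{PC}_{x,y-1}(G)} (-1)^{|c_E^{-1}([y-1])|}.$$ Here $\mathcal{PC}_{x,y}(G)$ denotes the set of compatible $(x,y)$-pairs of colorings of $G$.
   Context: $\mathbb{N}=\{0,1,2,\ldots\}$ and $[n]=\{1,\ldots,n\}$, $[0]=\emptyset$. Graphs are finite and simple: $G=(V(G),E(G))$ with $E(G)$ a set of unordered pairs of distinct vertices; the empty graph is allowed. $\mathrm{cc}$ denotes the number of connected components, and for $F\subseteq E(G)$, $G_{\mid F}$ is the graph with vertex set $V(G)$ and edge set $F$. The Fortuin-Kasteleyn polynomial is $Z_G(X,Y)=\sum_{F\subseteq E(G)} X^{\mathrm{cc}(G_{\mid F})}Y^{|F|}$. For $(x,y)\in\mathbb{N}\times\mathbb{N}$, a compatible $(x,y)$-pair of colorings of $G$ is a pair of maps $(c_V,c_E)$ with $c_V:V(G)\to\{1,\ldots,x\}$ and $c_E:E(G)\to\{0,\ldots,y\}$ such that for any $e=\{v,w\}\in E(G)$, $c_E(e)\neq 0$ if and only if $c_V(v)=c_V(w)$. The set of these is $\mathcal{PC}_{x,y}(G)$. *)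

(* Defs.v *)
From HB Require Import structures.
From mathcomp Require Import all_boot all_order all_algebra.

Set Implicit Arguments.
Unset Strict Implicit.
Unset Printing Implicit Defensive.

Import GRing.Theory.
Local Open Scope ring_scope.

Record graph := Graph {
  vert :> finType;
  edges : {set {set vert}};
  edgesP : forall e, e \in edges -> #|e| = 2%N
}.

(* Irreflexive, since [set v; v] has only one element. *)
Definition adj (G : graph) : rel G := [rel v w | [set v; w] \in edges G].

Definition cc (G : graph) : nat := n_comp (@adj G) [set: G].

Lemma restrict_subproof (G : graph) (F : {set {set G}}) (e : {set G}) :
  e \in edges G :&: F -> #|e| = 2%N.
Proof. by case/setIP=> /edgesP. Qed.

(* The intersection makes this total in F; for F \subset edges G the edge set
   is F itself. *)
Definition restrict (G : graph) (F : {set {set G}}) : graph :=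
  Graph (@restrict_subproof G F).

Definition FK_poly (G : graph) : {poly {poly int}} :=
  \sum_(F : {set {set G}} | F \subset edges G)
     'X ^+ cc (restrict F) * 'Y ^+ #|F|.

Definition edge (G : graph) : finType := {e : {set G} | e \in edges G}.

(* The vertex colors 1, ..., x are represented by 0, ..., x - 1; the edge
   colors are literally 0, ..., y. *)
Definition coloring_pair (G : graph) (x y : nat) : finType :=
  ({ffun G -> 'I_x} * {ffun edge G -> 'I_y.+1})%type.

Definition compatible (G : graph) (x y : nat) (c : coloring_pair G x y) : bool :=
  [forall e : edge G, forall v : G, forall w : G,
     (val e == [set v; w]) ==> ((c.2 e != ord0) == (c.1 v == c.1 w))].

Definition PC (x y : nat) (G : graph) : {set coloring_pair G x y} :=
  [set c | compatible c].

(* Main.v *)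
Require Import Defs.
From mathcomp Require Import all_boot all_order all_algebra.
From mathcomp Require Import zify.

Set Implicit Arguments.
Unset Strict Implicit.
Unset Printing Implicit Defensive.

Import Order.TTheory GRing.Theory Num.Theory.
Local Open Scope ring_scope.

(** Both identities are instances of one weighted count,
      Z_G(x, k z - 1) = sum of z ^ #{e | c_E e <> 0} over (c_V, c_E) in PC_{x,k},
    taken at (z, k) = (1, y + 1) and (z, k) = (-1, y - 1).

    Since x ^ cc(G|F) is the number of vertex colorings that are constant on the
    components of G|F ([card_coloring_connected]), that is, for which every edge
    of F is monochromatic ([card_coloring_restrict]), exchanging the sum over F
    with the sum over vertex colorings turns Z_G(x, Y) into the sum over c_V of
    the sum of Y ^ |F| over the sets F of monochromatic edges, which is
    (1 + Y) ^ m(c_V), with m(c_V) the number of monochromatic edges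
    ([horner_FK_monochromatic]).  On the other side, the edge colorings
    compatible with c_V are chosen edge by edge: a monochromatic edge contributes
    k nonzero colors of weight z, every other edge only the color 0, of weight 1,
    so that their total weight is (k z) ^ m(c_V) ([sum_PC_monochromatic]). *)

Lemma sum_subset_exp (R : comPzRingType) (T : finType) (M : {set T}) (y : R) :
  \sum_(F : {set T} | F \subset M) y ^+ #|F| = (1 + y) ^+ #|M|.
Proof.
(* (1 + y) ^+ #|M| is expanded as a product over all of T, where the factors
   outside M are 0 + 1, so that only the subsets of M contribute. *)
rewrite -prodr_const [RHS]big_mkcond /=.
rewrite (eq_bigr (fun i => (if i \in M then y else 0) + 1)); last first.
  by move=> i _; case: ifP; rewrite ?add0r // addrC.
rewrite bigA_distr /= big_mkcond; apply: eq_bigr => F _.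
rewrite -big_mkcond /=; case: ifPn => [/subsetP sFM | /subsetPn[i Fi Mi]].
  by rewrite -prodr_const; apply: eq_bigr => i /sFM ->.
by rewrite (bigD1 i) //= (negbTE Mi) mul0r.
Qed.

(** Such a coloring is constant on each connected component, hence freely
    determined by its values on the component representatives [roots e]. *)
Lemma card_coloring_connected (T A : finType) (e : rel T) :
  connect_sym e ->
  #|[set c : {ffun T -> A} | [forall v, forall w, e v w ==> (c v == c w)]]|
    = (#|A| ^ n_comp e T)%N.
Proof.
move=> symE.
pose rootT := {v : T | roots e v}.
pose rt v : rootT := Sub (fingraph.root e v) (roots_root symE v).
pose extend (g : {ffun rootT -> A}) : {ffun T -> A} := [ffun v => g (rt v)].
have rt_val (r : rootT) : rt (val r) = r.
  by apply: val_inj => /=; apply/eqP; exact: (valP r).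
have extend_inj : injective extend.
  by move=> g h /ffunP gh; apply/ffunP=> r; have := gh (val r); rewrite !ffunE rt_val.
have <- : #|{ffun rootT -> A}| = (#|A| ^ n_comp e T)%N.
  rewrite card_ffun card_sig; congr (_ ^ _)%N.
  by apply: eq_card => v; rewrite !inE andbT.
rewrite -(card_imset _ extend_inj); apply: eq_card => c; rewrite inE.
apply/idP/imsetP => [/forallP cP | [g _ ->]].
  exists [ffun r : rootT => c (val r)] => //; apply/ffunP => v; rewrite !ffunE /=.
  (* The color is constant along a path from v to its representative. *)
  have /connectP[p] := connect_root e v.
  elim: p v (fingraph.root e v) => [|w p IHp] v u /= => [_ -> //|/andP[evw ewp] ->].
  have /forallP/(_ w) := cP v; rewrite evw => /eqP ->; exact: IHp ewp _.
apply/'forall_forallP => v w; apply/implyP => evw; rewrite !ffunE.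
apply/eqP; congr (g _); apply: val_inj => /=.
by apply/(fingraph.rootP symE); exact: connect1.
Qed.

Section Colorings.

Variable G : graph.

(** A set of vertices is monochromatic if it meets at most one color; counting
    the image of [e] avoids choosing an ordering of the endpoints of an edge. *)
Definition mono (x : nat) (c : {ffun G -> 'I_x}) (e : {set G}) : bool :=
  (#|c @: e| <= 1)%N.

(** The set of monochromatic edges of [G], a set of the form over which the
    Fortuin-Kasteleyn sum ranges. *)
Definition mono_edges (x : nat) (c : {ffun G -> 'I_x}) : {set {set G}} :=
  [set e in edges G | mono c e].

Lemma mono_set2 (x : nat) (c : {ffun G -> 'I_x}) (v w : G) :
  mono c [set v; w] = (c v == c w).
Proof. by rewrite /mono imsetU1 imset_set1 cards2; case: eqP. Qed.

Lemma edge_set2 (e : {set G}) : e \in edges G -> exists v w, e = [set v; w].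
Proof. by move/edgesP/eqP/cards2P => [v [w [_ ->]]]; exists v, w. Qed.

Lemma adj_connect_sym (H : graph) : connect_sym (@adj H).
Proof. by apply: sym_connect_sym => v w; rewrite /adj /= setUC. Qed.

Lemma card_coloring_restrict (x : nat) (F : {set {set G}}) :
  F \subset edges G ->
  #|[set c : {ffun G -> 'I_x} | F \subset mono_edges c]|
    = (x ^ cc (restrict F))%N.
Proof.
move=> sFE; rewrite /cc (@eq_n_comp_r _ _ _ (restrict F)); last first.
  by move=> v; rewrite !inE.
rewrite -[in RHS](card_ord x) -card_coloring_connected; last exact: adj_connect_sym.
apply: eq_card => c; rewrite !inE; apply/subsetP/'forall_forallP => [sFc v w | cF e Fe].
  apply/implyP; rewrite /adj /= inE => /andP[_ /sFc].
  by rewrite inE mono_set2 => /andP[].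
have Ee := subsetP sFE e Fe; rewrite inE Ee /=.
have [v [w def_e]] := edge_set2 Ee; rewrite def_e in Fe Ee *.
by rewrite mono_set2; apply: (implyP (cF v w)); rewrite /adj /= inE Ee.
Qed.

Lemma horner_FK_monochromatic (x : nat) (y : int) :
  (FK_poly G).[x%:Z, y]
    = \sum_(c : {ffun G -> 'I_x}) (1 + y) ^+ #|mono_edges c|.
Proof.
transitivity (\sum_(F : {set {set G}} | F \subset edges G)
                \sum_(c : {ffun G -> 'I_x} | F \subset mono_edges c) y ^+ #|F|).
  rewrite /FK_poly !horner_sum; apply: eq_bigr => F sFE.
  rewrite sumr_const -[X in _ *+ X]cardsE card_coloring_restrict //.
  by rewrite !hornerE -mulr_natl natrX natz.
rewrite (exchange_big_dep xpredT) //=; apply: eq_bigr => c _.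
rewrite -sum_subset_exp; apply: eq_bigl => F; apply/andb_idl => sFM.
by apply: subset_trans sFM _; apply/subsetP => e; rewrite inE => /andP[].
Qed.

Lemma compatibleE (x k : nat) (cV : {ffun G -> 'I_x}) (cE : {ffun edge G -> 'I_k.+1}) :
  compatible (cV, cE) = [forall e, (cE e != ord0) == mono cV (val e)].
Proof.
apply/forallP/forallP => cP e; last first.
  apply/'forall_forallP => v w; apply/implyP => /eqP def_e.
  by have := cP e; rewrite def_e mono_set2.
have [v [w def_e]] := edge_set2 (valP e).
have /'forall_forallP/(_ v w) := cP e.
by rewrite def_e eqxx /= mono_set2.
Qed.

Lemma sum_PC_monochromatic (x k : nat) (z : int) :
  \sum_(c in PC x k G) z ^+ #|[set e : edge G | c.2 e != ord0]|
    = \sum_(cV : {ffun G -> 'I_x}) (z * k%:Z) ^+ #|mono_edges cV|.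
Proof.
(* The exponent counts the nonzero edge colors, so it is a product of weights
   over the edges. *)
pose wt (j : 'I_k.+1) : int := if j != ord0 then z else 1.
transitivity (\sum_(cV : {ffun G -> 'I_x})
    \sum_(cE : {ffun edge G -> 'I_k.+1} | compatible (cV, cE)) \prod_e wt (cE e)).
  rewrite pair_big_dep /=; apply: eq_big => [[cV cE]|[cV cE] _]; first by rewrite inE.
  rewrite -prodr_const big_mkcond /=; apply: eq_bigr => e _.
  by rewrite inE.
apply: eq_bigr => cV _.
transitivity (\prod_(e : edge G) \sum_(j | (j != ord0) == mono cV (val e)) wt j).
  (* Compatibility of c_E with a fixed c_V is a condition on each edge
     separately, so the sum over c_E distributes. *)
  rewrite bigA_distr_big_dep /=; apply: eq_bigl => cE.
  by rewrite compatibleE; apply/forallP/familyP.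
transitivity (\prod_(e : edge G) if mono cV (val e) then z * k%:Z else 1).
  apply: eq_bigr => e _; case: (mono cV (val e)).
    rewrite (eq_bigl (fun j => j != ord0)) => [|j]; last by rewrite eqb_id.
    rewrite (eq_bigr (fun=> z)); last by move=> j; rewrite /wt => ->.
    rewrite sumr_const -mulr_natr natz; congr (_ * Posz _).
    by rewrite (cardC1 (@ord0 k)) card_ord.
  rewrite (eq_bigl (pred1 ord0)) => [|j]; last by rewrite eqbF_neg negbK.
  by rewrite big_pred1_eq /wt eqxx.
rewrite -big_mkcond /= prodr_const; congr (_ ^+ _).
rewrite -(card_imset _ val_inj); apply: eq_card => e; rewrite inE.
apply/imsetP/andP => [[e' Me ->] | [Ee Me]]; first by split; [exact: valP | exact: Me].
by exists (Sub e Ee : edge G); rewrite //= ?SubK.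
Qed.

(** The weighted count of which both identities are instances. *)
Lemma horner_FK_sum_PC (x k : nat) (z : int) :
  (FK_poly G).[x%:Z, z * k%:Z - 1]
    = \sum_(c in PC x k G) z ^+ #|[set e : edge G | c.2 e != ord0]|.
Proof.
rewrite horner_FK_monochromatic sum_PC_monochromatic.
by apply: eq_bigr => cV _; rewrite addrC subrK.
Qed.

End Colorings.

Theorem proposition3p4 (G : graph) :
  (forall (x : nat) (y : int), -1 <= y ->
     (FK_poly G).[x%:Z, y] = #|PC x `|(y + 1)%R|%N G|%:Z) /\
  (forall (x : nat) (y : int), 1 <= y ->
     (FK_poly G).[x%:Z, - y] =
       \sum_(c in PC x `|(y - 1)%R|%N G)
          (-1) ^+ #|[set e : edge G | (1 <= c.2 e <= `|(y - 1)%R|)%N]|).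
Proof.
split=> x y y_ge.
  have y_def : y = 1 * `|(y + 1)%R|%N%:Z - 1 by lia.
  rewrite {1}y_def horner_FK_sum_PC.
  under eq_bigr => c _ do rewrite expr1n.
  by rewrite sumr_const natz.
have y_def : - y = -1 * `|(y - 1)%R|%N%:Z - 1 by lia.
rewrite y_def horner_FK_sum_PC; apply: eq_bigr => c _; congr (_ ^+ _).
(* The edge colors are at most |y - 1| by typing: being in [1, |y - 1|] means
   being nonzero. *)
by apply: eq_card => e; rewrite !inE leq_ord andbT lt0n.
Qed.
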